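(* Let $n\ge 1$. Suppose key $1$ is kept in hand and keys $2,\dots,n$ are put at random into boxes $1,\dots,n$, key $j$ being put in the random box $f(j)$, with a joint distribution such that whenever we condition on the contents of a set of boxes, each key not found in those boxes is distributed uniformly between the remaining ones. Precisely: for every $S\subseteq\{1,\dots,n\}$ and every possible outcome $C$ (of positive probability) of the contents $(f^{-1}(i))_{i\in S}$ of the boxes in $S$, for every key $j\in\{2,\dots,n\}$ that under $C$ is not in any box of $S$, and for every $b\in\{1,\dots,n\}\setminus S$, $$\Pr\bigl(f(j)=b \mid C\bigr)=\frac{1}{n-|S|}.$$ Then the probability of winning padlock solitaire is $1/n$.
   Context: Padlock solitaire: there are $n$ locked boxes labeled $1,\dots,n$; key $j$ opens box $j$ and only box $j$. The player keeps key $1$, and each key $j\in\{2,\dots,n\}$ is locked in some box $f(j)\in\{1,\dots,n\}$. The content of box $i$ is the set of keys $f^{-1}(i)=\{j: f(j)=i\}$. The player opens box $1$ with key $1$ and takes all keys in it; then, as long as the player holds a key to a box that is still locked, the player opens such a box and takes all keys in it. The player wins if all keys are eventually recovered, equivalently all boxes can be unlocked. Thus the set of boxes that get opened is the smallest set $O\subseteq\{1,\dots,n\}$ with $1\in O$ and such that $f(j)\in O$ implies $j\in O$, and the player wins if and only if $O=\{1,\dots,n\}$. The keys are not assumed to be placed independently of each other. *)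

(* Defs.v *)
From HB Require Import structures.
From mathcomp Require Import all_boot all_order all_algebra.
Set Implicit Arguments.
Unset Strict Implicit.
Unset Printing Implicit Defensive.

(* Keys and boxes are labelled by 0, ..., n-1 instead of 1, ..., n.           *)
Definition label1 (n : nat) (n_gt0 : 0 < n) : 'I_n := Ordinal n_gt0.

(* The keys other than the one kept in hand.                                  *)
Definition locked_key (n : nat) (n_gt0 : 0 < n) : finType :=
  {j : 'I_n | j != label1 n_gt0}.

Definition placement (n : nat) (n_gt0 : 0 < n) : Type :=
  locked_key n_gt0 -> 'I_n.

Definition box_content (n : nat) (n_gt0 : 0 < n) (f : placement n_gt0) (i : 'I_n) :
  {set locked_key n_gt0} := [set j | f j == i].

Definition closed_boxes (n : nat) (n_gt0 : 0 < n) (f : placement n_gt0)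
    (O : {set 'I_n}) : bool :=
  (label1 n_gt0 \in O) &&
  [forall j : locked_key n_gt0, (f j \in O) ==> (val j \in O)].

(* The smallest closed set of boxes, see opened_closed and opened_min.        *)
Definition opened (n : nat) (n_gt0 : 0 < n) (f : placement n_gt0) :
  {set 'I_n} := \bigcap_(O : {set 'I_n} | closed_boxes f O) O.

Lemma opened_closed (n : nat) (n_gt0 : 0 < n) (f : placement n_gt0) :
  closed_boxes f (opened f).
Proof.
apply/andP; split; first by apply/bigcapP => O /andP[].
apply/forallP => j; apply/implyP => /bigcapP fjO; apply/bigcapP => O cO.
by have /andP[_ /forallP/(_ j)/implyP] := cO; apply; apply: fjO.
Qed.

Lemma opened_min (n : nat) (n_gt0 : 0 < n) (f : placement n_gt0)
    (O : {set 'I_n}) : closed_boxes f O -> opened f \subset O.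
Proof. exact: bigcap_inf. Qed.

Definition wins (n : nat) (n_gt0 : 0 < n) (f : placement n_gt0) : bool :=
  opened f == [set: 'I_n].

From mathcomp Require Import all_classical all_reals all_analysis.
Local Open Scope classical_set_scope.
Local Open Scope ring_scope.

(* Only meaningful when P C > 0.                                              *)
Definition cond_prob (d : measure_display) (T : measurableType d)
    (R : realType) (P : probability T R) (A C : set T) : R :=
  fine (P (A `&` C)) / fine (P C).

(* The event that box i contains exactly the set of keys c i, for all i in S. *)
Definition contents_event (T : Type) (n : nat) (n_gt0 : (0 < n)%N)
    (f : T -> placement n_gt0) (S : {set 'I_n})
    (c : 'I_n -> {set locked_key n_gt0}) : set T :=
  [set w | forall i, i \in S -> box_content (f w) i = c i].

Definition conditionally_uniform (d : measure_display) (T : measurableType d)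
    (R : realType) (P : probability T R) (n : nat) (n_gt0 : (0 < n)%N)
    (f : T -> placement n_gt0) : Prop :=
  forall (S : {set 'I_n}) (c : 'I_n -> {set locked_key n_gt0}),
    (0 < P (contents_event f S c))%E ->
    forall j : locked_key n_gt0, (forall i, i \in S -> j \notin c i) ->
    forall b : 'I_n, b \notin S ->
      cond_prob P [set w | f w j = b] (contents_event f S c)
      = (n - #|S|)%N%:R^-1.

(* Main.v *)
Require Import Defs.
From HB Require Import structures.
From mathcomp Require Import all_boot all_order all_algebra.
From mathcomp Require Import ring.
Set Implicit Arguments.
Unset Strict Implicit.
Unset Printing Implicit Defensive.
Import GRing.Theory Num.Theory.
Local Open Scope ring_scope.

(** Open the boxes one at a time, always choosing a box whose key is owned.
    After s boxes have been opened, let h be the number of keys in hand whose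
    box is still locked; the quotient h / (n - s) is a martingale. Indeed each
    of the n - s - h missing keys is uniform over the n - s locked boxes, so the
    next box is expected to contain (n - s - h) / (n - s) keys, and
<<
      (h - 1 + (n - s - h) / (n - s)) / (n - s - 1) = h / (n - s).
>>
    The game may be stopped as soon as h = 0 (the player is stuck) or
    h = n - s (all keys are recovered), and then the martingale is 0 for a lost
    game and 1 for a won one. It starts at 1 / n, which is therefore the
    probability of winning.

    This is carried out for a weight [p] on the finite set of placements. A
    state of the game is a set [S] of opened boxes together with the contents
    of these boxes, given by a reference placement [g0]; conditioning on the
    state is summing over the placements that agree with [g0] on [S]. The
    one-step computation rests on [expected_box_content], and [weighted_wins]
    is optional stopping, proved by backward induction on the number of locked
    boxes. The law of the random placement is such a weight
    ([prob_finite_valued] turns probabilities into finite sums), and the theorem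
    is [weighted_wins] in the state where no box has been opened. *)

(** * Owned keys and opened boxes *)

(* Finite functions, so that sums may range over all placements. *)
Local Notation fin_placement n_gt0 := {ffun locked_key n_gt0 -> 'I_ _}.

Definition keys_found (n : nat) (n_gt0 : (0 < n)%N) (g : placement n_gt0)
    (S : {set 'I_n}) : {set locked_key n_gt0} := [set j | g j \in S]%SET.

(** Keys are named here by the boxes they open, so that
    [S \subset keys_owned g S] says that no opened box was forced. *)
Definition keys_owned (n : nat) (n_gt0 : (0 < n)%N) (g : placement n_gt0)
    (S : {set 'I_n}) : {set 'I_n} :=
  (label1 n_gt0 |: val @: keys_found g S)%SET.

(** The event on which one conditions once the boxes of [S] have been opened:
    [g0] only serves to record what was found there. *)
Definition same_contents (n : nat) (n_gt0 : (0 < n)%N) (S : {set 'I_n})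
    (g0 g : placement n_gt0) : bool :=
  [forall i in S, box_content g i == box_content g0 i].

Lemma same_contentsP (n : nat) (n_gt0 : (0 < n)%N) (S : {set 'I_n})
    (g0 g : placement n_gt0) :
  reflect (forall i, i \in S -> box_content g i = box_content g0 i)
    (same_contents S g0 g).
Proof.
apply: (iffP 'forall_implyP) => same i iS; first exact/eqP/same.
by rewrite same.
Qed.

Lemma same_contents_mem (n : nat) (n_gt0 : (0 < n)%N) (S : {set 'I_n})
    (g0 g : placement n_gt0) (i : 'I_n) (j : locked_key n_gt0) :
  same_contents S g0 g -> i \in S -> (g j == i) = (g0 j == i).
Proof.
move=> /'forall_implyP same iS.
by have /eqP/setP/(_ j) := same i iS; rewrite !inE.
Qed.

Lemma keys_found_same (n : nat) (n_gt0 : (0 < n)%N) (S : {set 'I_n})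
    (g0 g : placement n_gt0) :
  same_contents S g0 g -> keys_found g S = keys_found g0 S.
Proof.
move=> same; apply/setP => j; rewrite !inE; apply/idP/idP => jS.
  by have := same_contents_mem j same jS; rewrite eqxx => /esym/eqP ->.
by have := same_contents_mem j same jS; rewrite eqxx => /eqP ->.
Qed.

Lemma keys_owned_same (n : nat) (n_gt0 : (0 < n)%N) (S : {set 'I_n})
    (g0 g : placement n_gt0) :
  same_contents S g0 g -> keys_owned g S = keys_owned g0 S.
Proof. by rewrite /keys_owned => /keys_found_same ->. Qed.

(** Opening one more box refines the conditioning event by the content of that
    box alone. *)
Lemma same_contentsU1 (n : nat) (n_gt0 : (0 < n)%N) (b : 'I_n)
    (S : {set 'I_n}) (g0 g1 g : placement n_gt0) :
  same_contents S g0 g1 ->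
  same_contents (b |: S)%SET g1 g =
  same_contents S g0 g && (box_content g b == box_content g1 b).
Proof.
move=> /'forall_implyP same1; apply/'forall_implyP/andP.
  move=> same; split; last by apply: same; rewrite setU11.
  by apply/'forall_implyP => i iS; rewrite -(eqP (same1 i iS)) same// setU1r.
move=> [/'forall_implyP same gb] i /setU1P[-> //|iS].
by rewrite (eqP (same1 i iS)) same.
Qed.

Lemma card_keys_owned (n : nat) (n_gt0 : (0 < n)%N) (g : placement n_gt0)
    (S : {set 'I_n}) : #|keys_owned g S| = #|keys_found g S|.+1.
Proof.
rewrite cardsU1 card_imset; last exact: val_inj.
case: imsetP => [[j _ j1]|//].
by have := valP j; rewrite -j1 eqxx.
Qed.

Lemma card_keys_foundU1 (n : nat) (n_gt0 : (0 < n)%N) (g : placement n_gt0)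
    (S : {set 'I_n}) (b : 'I_n) : b \notin S ->
  #|keys_found g (b |: S)%SET| = (#|box_content g b| + #|keys_found g S|)%N.
Proof.
move=> bS.
have disj : #|box_content g b :&: keys_found g S|%SET = 0%N.
  apply/eqP; rewrite cards_eq0 -subset0; apply/subsetP => j.
  by rewrite !inE => /andP[/eqP ->]; rewrite (negPf bS).
rewrite -cardsUI disj addn0.
by apply: eq_card => j; rewrite !inE.
Qed.

Lemma card_locked_key (n : nat) (n_gt0 : (0 < n)%N) :
  #|locked_key n_gt0|.+1 = n.
Proof.
by rewrite card_sig (cardC1 (label1 n_gt0)) card_ord prednK.
Qed.

Lemma sub_keys_ownedU1 (n : nat) (n_gt0 : (0 < n)%N) (g : placement n_gt0)
    (S : {set 'I_n}) (b : 'I_n) :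
  S \subset keys_owned g S -> b \in keys_owned g S ->
  (b |: S)%SET \subset keys_owned g (b |: S)%SET.
Proof.
move=> SK bK; have KK : keys_owned g S \subset keys_owned g (b |: S)%SET.
  apply/setUS/imsetS/subsetP => j; rewrite !inE => ->.
  by rewrite orbT.
by rewrite subUset sub1set (subsetP KK)// (subset_trans SK).
Qed.

(** For the favourable stopping rule: once all keys are owned, the game is
    won. *)
Lemma keys_owned_sub_opened (n : nat) (n_gt0 : (0 < n)%N) (g : placement n_gt0)
    (S : {set 'I_n}) : S \subset opened g -> keys_owned g S \subset opened g.
Proof.
move=> SO; have /andP[O1 /forallP clos] := opened_closed g.
apply/subsetP => i /setU1P[-> //|/imsetP[j]]; rewrite inE => gjS ->.
by have /implyP := clos j; apply; apply: (subsetP SO).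
Qed.

(** For the unfavourable stopping rule: a player whose keys all belong to boxes
    that are already open is stuck. *)
Lemma opened_sub (n : nat) (n_gt0 : (0 < n)%N) (g : placement n_gt0)
    (S : {set 'I_n}) : keys_owned g S \subset S -> opened g \subset S.
Proof.
move=> KS; apply: opened_min; apply/andP; split.
  by rewrite (subsetP KS)// setU11.
apply/forallP => j; apply/implyP => gjS; rewrite (subsetP KS)//.
by rewrite setU1r// imset_f// inE.
Qed.

(** * The martingale for weights on placements *)

(** The conditional uniformity hypothesis, in unnormalised form: conditional
    probabilities are replaced by sums over the conditioning event. This form is
    also true when that event has weight zero, so that the induction on the
    states of the game need not set such states apart. *)
Definition uniform_weights (R : numFieldType) (n : nat) (n_gt0 : (0 < n)%N)
    (p : fin_placement n_gt0 -> R) : Prop :=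
  forall (S : {set 'I_n}) (g0 : fin_placement n_gt0)
      (j : locked_key n_gt0) (b : 'I_n),
    g0 j \notin S -> b \notin S ->
    \sum_(g : {ffun _} | same_contents S g0 g && (g j == b)) p g =
    (\sum_(g : {ffun _} | same_contents S g0 g) p g) / (n%:R - #|S|%:R).

(** By linearity of expectation: a key that was already found in [S] is not in
    [b], and each of the other [n - #|keys_owned g0 S|] keys is in [b] with
    conditional probability [1 / (n - #|S|)]. *)
Lemma expected_box_content (R : numFieldType) (n : nat) (n_gt0 : (0 < n)%N)
    (p : fin_placement n_gt0 -> R) (S : {set 'I_n})
    (g0 : fin_placement n_gt0) (b : 'I_n) :
  uniform_weights p -> b \notin S ->
  \sum_(g : {ffun _} | same_contents S g0 g) p g * #|box_content g b|%:R =
  (\sum_(g : {ffun _} | same_contents S g0 g) p g) / (n%:R - #|S|%:R) *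
  (n%:R - #|keys_owned g0 S|%:R).
Proof.
move=> unif bS.
under eq_bigr => g _ do rewrite cardsE -sum1_card natr_sum mulr_sumr.
under eq_bigr => g _ do under eq_bigr => j _ do rewrite mulr1.
rewrite (exchange_big_dep predT)//= (bigID (mem (keys_found g0 S)))/=.
rewrite big1 ?add0r => [|j]; last first.
  rewrite inE => gjS; apply: big_pred0 => g.
  apply/negbTE/negP => /andP[same gj].
  have gjb : g j = b by exact/eqP.
  have : j \in keys_found g S by rewrite (keys_found_same same) inE.
  by rewrite inE gjb (negPf bS).
under eq_bigr => j jK.
  have -> : \sum_(g : {ffun _} | same_contents S g0 g &&
        (j \in (fun x => g x == b))) p g =
      (\sum_(g : {ffun _} | same_contents S g0 g) p g) / (n%:R - #|S|%:R).
    rewrite -(unif S g0 j b)//.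
    by move: jK; rewrite inE.
  over.
rewrite sumr_const -[LHS]mulr_natr; congr (_ * _).
have -> : n%:R = #|[predC keys_found g0 S]|%:R + #|keys_owned g0 S|%:R :> R.
  rewrite -natrD card_keys_owned addnS addnC cardC.
  by rewrite -{1}(card_locked_key n_gt0).
by rewrite addrK.
Qed.

(** With [s = #|S|] and [h = #|keys_owned g0 S| - s] keys in hand, this says
    that the conditional probability of winning is [h / (n - s)]. The two
    hypotheses on [S] say that the state is reachable: every opened box had its
    key owned, and is opened in the actual game of each placement compatible
    with the state. If the player is stuck or owns all keys, the two sums agree
    term by term; otherwise one opens a further box [b], sums the induction
    hypothesis over the possible contents of [b], and uses the martingale
    identity. *)
Lemma weighted_wins (R : numFieldType) (n : nat) (n_gt0 : (0 < n)%N)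
    (p : fin_placement n_gt0 -> R) (S : {set 'I_n})
    (g0 : fin_placement n_gt0) :
  uniform_weights p -> S \subset keys_owned g0 S ->
  (forall g : fin_placement n_gt0,
    same_contents S g0 g -> S \subset opened g) ->
  \sum_(g : {ffun _} | same_contents S g0 g)
    p g * ((n%:R - #|S|%:R) * (wins g)%:R) =
  \sum_(g : {ffun _} | same_contents S g0 g)
    p g * (#|keys_owned g S|%:R - #|S|%:R).
Proof.
move=> unif; move: {2}(n - #|S|)%N (erefl (n - #|S|)%N) => k.
elim: k S g0 => [|k IH] S g0 Sk SK SO; apply/eqP; rewrite -subr_eq0;
    rewrite -sumrB; apply/eqP.
  have ST : S = setT.
    apply/eqP; rewrite eqEcard subsetT cardsT card_ord.
    by rewrite -subn_eq0 Sk.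
  apply: big1 => g same; rewrite (keys_owned_same same).
  have -> : keys_owned g0 S = setT.
    by apply/eqP; rewrite eqEsubset subsetT -{1}ST.
  by rewrite ST cardsT card_ord !subrr mul0r subrr.
have Sn : (#|S| < n)%N by rewrite -subn_gt0 Sk.
have [KS|/subsetPn[b bK bS]] := boolP (keys_owned g0 S \subset S).
  have KSE : keys_owned g0 S = S by apply/eqP; rewrite eqEsubset KS SK.
  apply: big1 => g same; rewrite (keys_owned_same same) KSE subrr mulr0 subr0.
  suff /negPf -> : ~~ wins g by rewrite !mulr0.
  apply/negP => /eqP win; move: Sn.
  rewrite ltnNge -{1}(card_ord n) -cardsT -win subset_leq_card//.
  by apply: opened_sub; rewrite (keys_owned_same same).
have [KT|KT] := eqVneq (keys_owned g0 S) setT.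
  apply: big1 => g same; rewrite (keys_owned_same same) KT.
  suff -> : wins g by rewrite mulr1 cardsT card_ord subrr.
  rewrite /wins eqEsubset subsetT -KT -(keys_owned_same same).
  exact/keys_owned_sub_opened/SO.
(* A key outside [keys_owned g0 S] is missing, so [b] is not the last locked
   box; this makes [n - s - 1] nonzero, by which the identity is divided. *)
have bSn : (#|b |: S|%SET < n)%N.
  suff /proper_card : (b |: S)%SET \proper [set: 'I_n].
    by rewrite cardsT card_ord.
  apply: (@sub_proper_trans _ _ (keys_owned g0 S)); last by rewrite properT.
  by rewrite subUset sub1set bK.
have cardbS : #|b |: S|%SET = #|S|.+1 by rewrite cardsU1 bS.
(* The induction hypothesis in each of the states reached by opening [b],
   summed over the contents [c] of [b]; contents that are incompatible with
   the current state contribute nothing. *)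
have step : \sum_(g : {ffun _} | same_contents S g0 g)
    p g * ((n%:R - #|S|.+1%:R) * (wins g)%:R) =
  \sum_(g : {ffun _} | same_contents S g0 g)
    p g * (#|keys_owned g (b |: S)%SET|%:R - #|S|.+1%:R).
  rewrite (partition_big (fun g : {ffun _} => box_content g b) xpredT)//=.
  rewrite [RHS](partition_big (fun g : {ffun _} => box_content g b) xpredT)//=.
  apply: eq_bigr => c _.
  pose fits (g : fin_placement n_gt0) :=
    same_contents S g0 g && (box_content g b == c).
  have [g1 /andP[same1 /eqP g1c]|none] := pickP fits; last first.
    by rewrite !big_pred0.
  have fitsE g : fits g = same_contents (b |: S)%SET g1 g.
    by rewrite (same_contentsU1 _ _ same1) g1c.
  rewrite !(eq_bigl _ _ fitsE) -cardbS; apply: IH.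
  - by rewrite cardbS subnS Sk.
  - by apply: sub_keys_ownedU1; rewrite (keys_owned_same same1).
  - move=> g; rewrite -fitsE => /andP[same _].
    rewrite subUset SO// andbT sub1set.
    apply: (subsetP (keys_owned_sub_opened (SO _ same))).
    by rewrite (keys_owned_same same).
(* [a] is the number of keys in hand and [m] the number of locked boxes; [stepE]
   is [step] with the expected number of new keys substituted. *)
pose a : R := #|keys_owned g0 S|%:R - #|S|%:R.
pose m : R := n%:R - #|S|%:R.
pose q := \sum_(g : {ffun _} | same_contents S g0 g) p g.
pose W := \sum_(g : {ffun _} | same_contents S g0 g) p g * (wins g)%:R.
have m_neq0 : m != 0 by rewrite /m subr_eq0 eqr_nat gtn_eqF.
have m1_neq0 : m - 1 != 0.
  by rewrite /m -addrA -opprD natr1 subr_eq0 eqr_nat gtn_eqF// -cardbS.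
have stepE : (m - 1) * W = (a - 1) * q + q / m * (m - a).
  have -> : (m - 1) * W = \sum_(g : {ffun _} | same_contents S g0 g)
    p g * ((n%:R - #|S|.+1%:R) * (wins g)%:R).
    rewrite mulr_sumr; apply: eq_bigr => g _; rewrite -natr1 /m; ring.
  rewrite step.
  have -> : m - a = n%:R - #|keys_owned g0 S|%:R by rewrite /m /a; ring.
  rewrite -(expected_box_content g0 unif bS) mulr_sumr -big_split/=.
  apply: eq_bigr => g same.
  rewrite card_keys_owned card_keys_foundU1// /a -(keys_owned_same same).
  rewrite card_keys_owned -addnS natrD -[#|S|.+1%:R]natr1; ring.
rewrite sumrB.
have -> : \sum_(g : {ffun _} | same_contents S g0 g)
    p g * ((n%:R - #|S|%:R) * (wins g)%:R) = m * W.
  by rewrite mulr_sumr; apply: eq_bigr => g _; rewrite mulrCA.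
have -> : \sum_(g : {ffun _} | same_contents S g0 g)
    p g * (#|keys_owned g S|%:R - #|S|%:R) = a * q.
  rewrite mulr_sumr; apply: eq_bigr => g same.
  by rewrite (keys_owned_same same) mulrC.
apply/eqP; rewrite subr_eq0; apply/eqP/(mulfI m1_neq0).
rewrite mulrCA stepE; field.
exact: m_neq0.
Qed.

From mathcomp Require Import all_classical all_reals all_analysis.
Local Open Scope classical_set_scope.

(** * The law of a random placement *)

Lemma prob_finite_valued (d : measure_display) (T : measurableType d)
    (R : realType) (P : probability T R) (I : finType) (X : T -> I)
    (X_meas : forall i, measurable [set w | X w = i]) (Q : pred I) :
  P [set w | Q (X w)] = (\sum_(i | Q i) fine (P [set w | X w = i]))%:E.
Proof.
have -> : [set w | Q (X w)] = \bigcup_(i in [set` enum Q]) [set w | X w = i].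
  apply/seteqP; split => [w QX|w [i /= iQ Xw]]; last first.
    by rewrite Xw; rewrite mem_enum in iQ.
  by exists (X w); rewrite //= mem_enum.
rewrite measure_fin_bigcup//; last first.
  by move=> i j _ _ [w [/= -> ->]].
rewrite -fsbig_seq ?enum_uniq// big_enum -sumEFin.
by apply: eq_bigr => i _; rewrite fineK// fin_num_measure.
Qed.

Theorem theorem5 (d : measure_display) (T : measurableType d) (R : realType)
    (P : probability T R) (n : nat) (n_gt0 : (0 < n)%N)
    (f : T -> placement n_gt0)
    (f_meas : forall (j : locked_key n_gt0) (b : 'I_n),
        measurable [set w : T | f w j = b])
    (f_unif : conditionally_uniform P f) :
  P [set w : T | wins (f w)] = (n%:R^-1)%:E.
Proof.
pose X w : fin_placement n_gt0 := finfun (f w).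
have XE w : X w = f w :> placement n_gt0 by apply/funext => j; rewrite ffunE.
have X_meas g : measurable [set w | X w = g].
  have -> : [set w | X w = g] = \bigcap_(j in setT) [set w | f w j = g j].
    apply/seteqP; split => w /=; first by move=> <- j _ /=; rewrite -XE.
    by move=> fg; apply/ffunP => j; rewrite ffunE; apply: fg.
  by apply: fin_bigcap_measurable => // j _; exact: f_meas.
pose p g := fine (P [set w | X w = g]).
have PX (Q : pred (fin_placement n_gt0)) :
    P [set w | Q (X w)] = (\sum_(g | Q g) p g)%:E.
  exact: prob_finite_valued.
have p_ge0 g : 0 <= p g by exact: fine_ge0.
(* When the conditioning event has probability zero there is no conditional
   probability to speak of, but then all the weights in it vanish. *)
have p_unif : uniform_weights p.
  move=> S g0 j b jS bS.
  pose same (g : fin_placement n_gt0) := same_contents S g0 g.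
  have EC : contents_event f S (box_content g0) = [set w | same (X w)].
    by apply/seteqP; split=> w /=; rewrite /same XE => /same_contentsP.
  have [p0|p_neq0] := eqVneq (\sum_(g : {ffun _} | same g) p g) 0.
    rewrite p0 mul0r big1// => g /andP[sg _].
    exact: (psumr_eq0P (fun g _ => p_ge0 g) p0).
  have C_gt0 : (0 < P (contents_event f S (box_content g0)))%E.
    by rewrite EC PX lte_fin lt0r p_neq0 sumr_ge0.
  have j_out i : i \in S -> j \notin box_content g0 i.
    by rewrite inE => iS; apply: contra jS => /eqP ->.
  have := f_unif S (box_content g0) C_gt0 j j_out b bS.
  have EA : [set w | f w j = b] `&` contents_event f S (box_content g0) =
      [set w | [pred g : fin_placement n_gt0 | same g && (g j == b)] (X w)].
    rewrite EC; apply/seteqP; split=> w /=; rewrite XE.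
      by move=> [-> ->]; rewrite eqxx.
    by move=> /andP[-> /eqP].
  rewrite /cond_prob EA EC !PX /= => /(canRL (divfK p_neq0)) ->.
  by rewrite mulrC natrB// -[X in (_ <= X)%N](card_ord n) max_card.
have all_same (g0 g : fin_placement n_gt0) :
    same_contents finset.set0 g0 g.
  by apply/same_contentsP => i; rewrite inE.
have g0 : fin_placement n_gt0 := [ffun=> label1 n_gt0].
have := @weighted_wins _ _ _ p finset.set0 g0 p_unif (finset.sub0set _)
  (fun g _ => finset.sub0set _).
under eq_bigl do rewrite all_same.
under [RHS]eq_bigl do rewrite all_same.
have -> : [set w | wins (f w)] =
    [set w | [pred g : fin_placement n_gt0 | wins (g : placement n_gt0)] (X w)].
  by apply/seteqP; split=> w /=; rewrite XE.
rewrite PX.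
(* Before any box is opened, only the key kept in hand is owned: h = 1. *)
have owned1 (g : placement n_gt0) : #|keys_owned g finset.set0| = 1%N.
  rewrite card_keys_owned; congr _.+1; apply/eqP.
  by rewrite cards_eq0 -finset.subset0; apply/fintype.subsetP => j; rewrite !inE.
under [RHS]eq_bigr do rewrite owned1 cards0 subr0 mulr1.
have -> : \sum_g p g = 1.
  have := PX xpredT.
  have -> : [set w | xpredT (X w)] = [set: T] by apply/seteqP; split.
  by rewrite probability_setT => -[].
move=> n_win; congr (_%:E).
have n_neq0 : n%:R != 0 :> R by rewrite pnatr_eq0 -lt0n.
apply: (mulfI n_neq0); rewrite divff// -[RHS]n_win [in LHS]big_mkcond mulr_sumr.
apply: eq_bigr => g _; rewrite cards0 subr0 /=.
by case: (wins g); rewrite ?mulr1 ?mulr0 1?mulrC.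
Qed.
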